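(* Write $\eta_u=\eta(u,0)$. Let $c$ be a constant, let $\tilde e_j(u,\eta_u)\in\mathbb{R}[u,\eta_u]^d$ ($j=1,\dots,p$) span $((\nabla_u\eta(u,0))^{\perp_{\bar G}})^{\perp_E}$ for every $u$, and let $h_j(X,u,\eta_u,t)\in\mathbb{R}[X,u,\eta_u][t]_3$ (degree $=3$ in $t$) for $j=1,\dots,p$. Then every system of polynomial equations of the form $$(X-\eta_u)^\top\tilde e_j(u,\eta_u)+c\cdot h_j(X,u,\eta_u,X-\eta_u)=0\qquad\text{for } j=1,\dots,p$$ gives a second-order efficient estimator, i.e. the estimator $\eta(u,v)$ it defines satisfies $$\left.\sum_{i=1}^d\left(\frac{\partial^2\eta_i(u,v)}{\partial v^\kappa\,\partial v^\lambda}\right)\left(\frac{\partial\theta^i(u,v)}{\partial u^a}\right)\right|_{v=0}=0\qquad\text{for all }\kappa,\lambda\in\{1,\dots,d-p\},\ a\in\{1,\dots,p\}.$$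
   Context: Full exponential family: $dP(x|\theta)=\exp(\sum_i x_i\theta^i-\psi(\theta))\,d\nu$, $x\in\mathbb{R}^d$, $\theta\in\Theta\subset\mathbb{R}^d$, with carrier measure $\nu$ and potential $\psi$. The expectation parameter is $\eta(\theta)=E[x|\theta]=\nabla_\theta\psi(\theta)$. The Fisher metric with respect to $\theta$ is $g_{ij}=\partial^2\psi/\partial\theta^i\partial\theta^j$, and $\bar G=(g^{ij})$, its inverse matrix, is the Fisher metric with respect to $\eta$. The model is a curved exponential family of dimension $p$, with natural parameter set $\mathcal{V}_\Theta\subset\Theta$ and expectation parameter set $\mathcal{V}_E=\eta(\mathcal{V}_\Theta)\subset\mathbb{R}^d$. It is algebraic: $\mathcal{V}_\Theta$ or $\mathcal{V}_E$ is represented by a real algebraic variety, and the map $\theta\mapsto\eta(\theta)$ or its inverse is locally represented by polynomial equations in $(\theta,\eta)$. It is assumed non-singular around the true parameter. An estimator is given by a local coordinate system $(u,v)\in\mathbb{R}^p\times\mathbb{R}^{d-p}$ around the true parameter, $(u,v)\mapsto\eta(u,v)$, such that $v=0$ gives the model $\mathcal{V}_E$. The sample mean $X\in\mathbb{R}^d$ is written $X=\eta(u,v)$ and the estimate is $u$. The estimator defined by a system of equations in $X$ and $u$ is the one for which the equations hold when $X=\eta(u,v)$ is substituted. $\theta(u,v)$ is the natural parameter corresponding to $\eta(u,v)$. The constant $c$ controls the perturbation from the maximum likelihood estimator. $(\nabla_u\eta(u,0))^{\perp_{\bar G}}$ is the subspace orthogonal to $\mathrm{span}(\partial_{u^a}\eta(u,0))_{a=1}^p$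 with respect to $\bar G$, and $(\cdot)^{\perp_E}$ is the Euclidean orthogonal complement. $\mathbb{R}[X,u,\eta_u][t]_3$ denotes the polynomials of degree 3 in $t\in\mathbb{R}^d$ with coefficients in $\mathbb{R}[X,u,\eta_u]$, where the degree of a polynomial means the maximum degree of its terms. The displayed condition is the vanishing at $v=0$ of the components $\Gamma^{(m)}_{\kappa\lambda,a}$ of the m-connection. For a first-order efficient estimator it implies second-order efficiency after a bias correction, i.e. optimality among the bias-corrected first-order efficient estimators up to $O(N^{-2})$, where $N$ is the sample size.
   Formalization: The polynomials h_j are taken homogeneous of degree 3 in t (every term in t has degree exactly 3, zero allowed); with lower-degree terms permitted the claim fails, e.g. for h = t_2^2 + t_2^3. *)

(* Defs.v *)
(* [mpoly] is imported without its notations, which clash with those of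
   mathcomp-analysis. *)
From HB Require Import structures.
From mathcomp Require Import all_boot all_order all_algebra.
From mathcomp Require Import all_classical all_reals all_analysis.
From mathcomp Require Import -(notations) mpoly.

Set Implicit Arguments.
Unset Strict Implicit.
Unset Printing Implicit Defensive.

Import Order.TTheory GRing.Theory Num.Theory.
Import numFieldNormedType.Exports.

Local Open Scope classical_set_scope.
Local Open Scope ring_scope.

Definition mpeval (R : realType) (n : nat) (f : mpoly n R)
  (x : 'rV[R]_n) : R := meval (fun i => x 0 i) f.

Definition zero_locus (R : realType) (n : nat) (F : seq (mpoly n R)) :
  set 'rV[R]_n := [set x | forall f, f \in F -> mpeval f x = 0].

Definition poly_jacobian (R : realType) (n : nat) (F : seq (mpoly n R))
  (x : 'rV[R]_n) : 'M[R]_(size F, n) :=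
  \matrix_(i < size F, j < n) mpeval (mderiv j F`_i) x.

(* [U] and [V] are finite dimensional in all uses, so that differentiability of
   all directional derivatives is differentiability of the differential. *)
Definition twice_differentiable_on (R : realType) (U V : normedModType R)
  (A : set U) (f : U -> V) : Prop :=
  forall x, A x ->
    differentiable f x /\ forall h : U, differentiable ('D_h f) x.

Definition gradient (R : realType) (d : nat) (f : 'rV[R]_d -> R)
  (x : 'rV[R]_d) : 'rV[R]_d := \row_i 'D_(delta_mx 0 i) f x.

Definition hessian (R : realType) (d : nat) (f : 'rV[R]_d -> R)
  (x : 'rV[R]_d) : 'M[R]_d :=
  \matrix_(i, j) 'D_(delta_mx 0 i) ('D_(delta_mx 0 j) f) x.

(* The sample space R^d is [d.-tuple R], which carries the product of the
   Borel sigma-algebras in the library; parameters are row vectors. *)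
Definition exp_density (R : realType) (d : nat) (psi : 'rV[R]_d -> R)
  (theta : 'rV[R]_d) (x : d.-tuple (measurableTypeR R)) : R :=
  expR (\sum_(i < d) tnth x i * theta 0 i - psi theta).

Definition expectation_param (R : realType) (d : nat)
  (nu : {measure set (d.-tuple (measurableTypeR R)) -> \bar R})
  (psi : 'rV[R]_d -> R) (theta : 'rV[R]_d) : 'rV[R]_d :=
  \row_i (\int[nu]_x (tnth x i * exp_density psi theta x)).

(* The fields [ef_smooth] and [ef_expectation] follow from [ef_open] and
   [ef_total_mass] by differentiation under the integral sign; they are the
   standing regularity facts on the potential. *)
Record exponential_family (R : realType) (d : nat)
  (nu : {measure set (d.-tuple (measurableTypeR R)) -> \bar R})
  (psi : 'rV[R]_d -> R) (Theta : set 'rV[R]_d) : Prop := {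
  ef_open : open Theta;
  ef_total_mass : forall theta, Theta theta ->
    (\int[nu]_x (exp_density psi theta x)%:E = 1)%E;
  ef_smooth : twice_differentiable_on Theta psi;
  ef_expectation : forall theta, Theta theta ->
    expectation_param nu psi theta = gradient psi theta;
  ef_nondegenerate : forall theta, Theta theta ->
    hessian psi theta \in unitmx }.

(* [V] is cut out in the parameter set [S] by polynomials satisfying the
   Jacobian criterion for dimension [p] around [x0]. *)
Definition nonsingular_variety (R : realType) (d p : nat)
  (S V : set 'rV[R]_d) (x0 : 'rV[R]_d) : Prop :=
  exists F : seq (mpoly d R),
    V = S `&` zero_locus F /\
    \forall x \near x0, V x -> \rank (poly_jacobian F x) = (d - p)%N.

(* A map and its local inverse have the same graph, so "the map or its inverse
   is represented by polynomial equations" is one condition on the graph. *)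
Definition locally_polynomial_graph (R : realType) (d : nat)
  (eta : 'rV[R]_d -> 'rV[R]_d) (theta0 : 'rV[R]_d) : Prop :=
  exists H : seq (mpoly (d + d) R),
    \forall z \near (theta0, eta theta0),
      z.2 = eta z.1 <-> zero_locus H (row_mx z.1 z.2).

Definition algebraic_model (R : realType) (d p : nat)
  (eta : 'rV[R]_d -> 'rV[R]_d) (Theta VTheta : set 'rV[R]_d)
  (theta0 : 'rV[R]_d) : Prop :=
  [/\ VTheta `<=` Theta,
      VTheta theta0,
      nonsingular_variety p Theta VTheta theta0 \/
      nonsingular_variety p (eta @` Theta) (eta @` VTheta) (eta theta0) &
      locally_polynomial_graph eta theta0].

(* A coordinate system (u,v) on a neighbourhood [W] of (u0,0), in which a point
   of the full family has natural parameter [thetauv (u,v)] and expectation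
   parameter [etauv (u,v)]; the model is the slice v = 0. *)
Record estimator (R : realType) (d p : nat)
  (eta : 'rV[R]_d -> 'rV[R]_d) (Theta VTheta : set 'rV[R]_d)
  (W : set ('rV[R]_p * 'rV[R]_(d - p)))
  (thetauv etauv : 'rV[R]_p * 'rV[R]_(d - p) -> 'rV[R]_d)
  (u0 : 'rV[R]_p) : Prop := {
  est_open : open W;
  est_base : W (u0, 0);
  est_smooth : twice_differentiable_on W etauv;
  est_inj : set_inj W etauv;
  est_diffeo : forall w, W w -> bijective ('d etauv w);
  est_natural : forall w, W w ->
    [/\ Theta (thetauv w), eta (thetauv w) = etauv w
      & differentiable thetauv w];
  est_model : forall w, W w -> (eta @` VTheta) (etauv w) <-> w.2 = 0 }.

Definition dir_u (R : realType) (p q : nat) (a : 'I_p) :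
  'rV[R]_p * 'rV[R]_q := (delta_mx 0 a, 0).

Definition dir_v (R : realType) (p q : nat) (k : 'I_q) :
  'rV[R]_p * 'rV[R]_q := (0, delta_mx 0 k).

Definition tangent_mx (R : realType) (d p q : nat)
  (etauv : 'rV[R]_p * 'rV[R]_q -> 'rV[R]_d) (u : 'rV[R]_p) : 'M[R]_(p, d) :=
  \matrix_(a, i) 'D_(dir_u R q a) (fun w => etauv w 0 i) (u, 0).

(* Subspaces are row spaces: the rows of [orth G A] span the vectors w such
   that s *m G *m w^T = 0 for every row s of A. *)
Definition orth (R : realType) (d m : nat) (G : 'M[R]_d) (A : 'M[R]_(m, d)) :
  'M[R]_d := kermx (A *m G)^T.

(* R[u, eta_u]^d *)
Definition poly_vector (R : realType) (d p : nat) : Type :=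
  'I_d -> mpoly (p + d) R.

Definition eval_vector (R : realType) (d p : nat) (e : poly_vector R d p)
  (u : 'rV[R]_p) (etau : 'rV[R]_d) : 'rV[R]_d :=
  \row_i mpeval (e i) (row_mx u etau).

(* R[X, u, eta_u][t] *)
Definition poly_in_t (R : realType) (d p : nat) : Type :=
  mpoly d (mpoly (d + p + d) R).

Definition eval_in_t (R : realType) (d p : nat) (h : poly_in_t R d p)
  (X : 'rV[R]_d) (u : 'rV[R]_p) (etau t : 'rV[R]_d) : R :=
  mpeval
    (map_mpoly (fun a => mpeval a (row_mx (row_mx X u) etau)) h) t.

(* R[X, u, eta_u][t]_3 is the graded piece: every monomial in t occurring in
   [h] has total degree exactly 3.  Terms of degree 1 or 2 in t must be
   excluded; higher order terms in t = X - eta_u are still covered, since the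
   coefficients may depend on X and eta_u. *)
Definition cubic_in_t (R : realType) (d p : nat) (h : poly_in_t R d p) : Prop :=
  h \is ishomog1 3 mdeg.

(* Main.v *)
Require Import Defs.
From HB Require Import structures.
From mathcomp Require Import all_boot all_order all_algebra.
From mathcomp Require Import all_classical all_reals all_analysis.
From mathcomp Require Import -(notations) mpoly.

Set Implicit Arguments.
Unset Strict Implicit.
Unset Printing Implicit Defensive.

Import Order.TTheory GRing.Theory Num.Theory.
Import numFieldNormedType.Exports.

Local Open Scope classical_set_scope.
Local Open Scope ring_scope.

(** Fix u and move along the slice of points (u, v).  On it the estimating
    equation reads <eta(u,v) - eta(u,0), e_j> = - c h_j, and its right-hand side
    is a sum of terms, each containing a product of three coordinates of
    eta(u,v) - eta(u,0).  Each coordinate vanishes at v = 0, so by the Leibniz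
    rule the right-hand side has zero value and zero first and second
    derivatives at v = 0.  Hence the second derivatives of eta in the
    directions v are Euclidean-orthogonal to every e_j
    ([cubic_equation_derive2]).

    It remains to see that the vectors d theta / d u^a lie in the span of the
    e_j.  On the parameter set eta is the gradient of psi, so the chain rule
    gives d eta / d u^a = (d theta / d u^a) H with H the Hessian of psi
    ([tangent_mx_natural]); multiplying by Gbar = H^-1 turns tangent vectors
    into the derivatives of theta.  On the other hand A Gbar is contained in
    the Euclidean orthogonal complement of the Gbar-orthogonal complement of A
    ([sub_orth_orth]), and that space is spanned by the e_j.

    The orders of vanishing are tracked by [vanishing], a second-order jet
    condition using derivatives in two fixed directions only; it is
    multiplicative ([vanishingM]), so that a product of three factors of order
    one has order three, whatever the regular factor in front. *)

(** * Order of vanishing along two directions *)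

(** The cases n = 0, 1, 2, 3 say that the 2-jet of f at x along (k, l) exists,
    and that its part of degree below n is zero.  The second derivative is the
    iterated one, first along l and then along k: it depends on the derivative
    along l in a neighbourhood of x, but on the derivative along k only at x. *)
Record vanishing (R : realType) (V : normedModType R) (k l : V) (n : nat)
  (f : V -> R) (x : V) : Prop := Vanishing {
  van_derl : \forall y \near x, derivable f y l;
  van_derk : derivable f x k;
  van_derkl : derivable ('D_l f) x k;
  van_value : (0 < n)%N -> f x = 0;
  van_dk : (1 < n)%N -> 'D_k f x = 0;
  van_dl : (1 < n)%N -> 'D_l f x = 0;
  van_dkl : (2 < n)%N -> 'D_k ('D_l f) x = 0 }.

Section Vanishing.
Context (R : realType) (V : normedModType R) (k l : V).
Implicit Types (f g : V -> R) (x : V).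

(** The numerical core of the Leibniz rule: a, b are the values of factors
    vanishing to orders m and n, and a', b' their first derivatives. *)
Lemma leibniz_vanish m n (a a' b b' : R) :
  (1 < m + n)%N -> ((0 < m)%N -> a = 0) -> ((1 < m)%N -> a' = 0) ->
  ((0 < n)%N -> b = 0) -> ((1 < n)%N -> b' = 0) -> a * b' + b * a' = 0.
Proof.
case: m n => [|[|m]] [|[|n]]// _.
- by move=> _ _ /(_ isT)-> /(_ isT)->; rewrite mulr0 mul0r addr0.
- by move=> /(_ isT)-> _ /(_ isT)->; rewrite !mul0r addr0.
- by move=> /(_ isT)-> _ /(_ isT)->; rewrite !mul0r addr0.
- by move=> /(_ isT)-> /(_ isT)->; rewrite mul0r mulr0 addr0.
- by move=> /(_ isT)-> /(_ isT)->; rewrite mul0r mulr0 addr0.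
- by move=> /(_ isT)-> /(_ isT)->; rewrite mul0r mulr0 addr0.
Qed.

Lemma near_eq_derive2 f g x :
  (\forall y \near x, f y = g y) -> 'D_k ('D_l f) x = 'D_k ('D_l g) x.
Proof.
by move=> /near_join fg; apply: near_eq_derive; apply: filterS fg => y;
  exact: near_eq_derive.
Qed.

Lemma derive_fun_cst (a : R) : 'D_l (cst a : V -> R) = cst 0.
Proof. by apply/funext => y; rewrite derive_cst. Qed.

Lemma vanishing_cst (a : R) x : vanishing k l 0 (cst a) x.
Proof.
split=> [| | |//|//|//|//].
- by near=> y; exact: derivable_cst.
- exact: derivable_cst.
- by rewrite derive_fun_cst; exact: derivable_cst.
Unshelve. all: by end_near. Qed.

Lemma vanishing0 n x : vanishing k l n (cst 0) x.
Proof.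
have [dl dk dkl _ _ _ _] := vanishing_cst 0 x.
split; [exact: dl|exact: dk|exact: dkl| | | |].
- by [].
- by rewrite derive_cst.
- by rewrite derive_cst.
- by rewrite derive_fun_cst derive_cst.
Qed.

Lemma vanishingD n f g x :
  vanishing k l n f x -> vanishing k l n g x ->
  vanishing k l n (f + g) x.
Proof.
move=> [fl fk fkl f0 f1k f1l f2] [gl gk gkl g0 g1k g1l g2].
have Dl : \forall y \near x, 'D_l f y + 'D_l g y = 'D_l (f + g) y.
  apply: filterS2 fl gl => y fy gy; by rewrite (deriveD fy gy).
split.
- apply: filterS2 fl gl => y fy gy; exact: (derivableD fy gy).
- exact: (derivableD fk gk).
- by apply: near_eq_derivable Dl _; exact: (derivableD fkl gkl).
- by move=> n0; rewrite fctE (f0 n0) (g0 n0) addr0.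
- by move=> n1; rewrite (deriveD fk gk) (f1k n1) (g1k n1) addr0.
- by move=> n1; rewrite -(nbhs_singleton Dl) (f1l n1) (g1l n1) addr0.
- move=> n2; rewrite -(near_eq_derive k Dl) (deriveD fkl gkl).
  by rewrite (f2 n2) (g2 n2) addr0.
Qed.

(** Every term of the Leibniz expansion of the 2-jet distributes at most two
    derivatives over the two factors, so when m + n exceeds the number of
    derivatives one of the factors is differentiated less than its order. *)
Lemma vanishingM m n f g x :
  vanishing k l m f x -> vanishing k l n g x ->
  vanishing k l (m + n) (f * g) x.
Proof.
move=> [fl fk fkl f0 f1k f1l f2] [gl gk gkl g0 g1k g1l g2].
have Dl : \forall y \near x, (f * 'D_l g + g * 'D_l f) y = 'D_l (f * g) y.
  apply: filterS2 fl gl => y fy gy; by rewrite (deriveM fy gy).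
split.
- apply: filterS2 fl gl => y fy gy; exact: (derivableM fy gy).
- exact: (derivableM fk gk).
- apply: near_eq_derivable Dl _.
  exact: (derivableD (derivableM fk gkl) (derivableM gk fkl)).
- by rewrite fctE addn_gt0 => /orP[/f0->|/g0->]; rewrite ?mul0r ?mulr0.
- by move=> mn; rewrite (deriveM fk gk); apply: (leibniz_vanish mn).
- by move=> mn; rewrite -(nbhs_singleton Dl); apply: (leibniz_vanish mn).
- move=> mn; rewrite -(near_eq_derive k Dl).
  rewrite (deriveD (derivableM fk gkl) (derivableM gk fkl)).
  rewrite (deriveM fk gkl) (deriveM gk fkl) /GRing.scale /=.
  (* The rest is arithmetic on the eight numbers of the two jets: for each pair
     of orders with sum at least 3, the hypotheses kill a factor in each of the
     four terms. *)
  move: f0 f1k f1l f2 g0 g1k g1l g2.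
  move: (f x) ('D_l f x) ('D_k f x) ('D_k ('D_l f) x).
  move: (g x) ('D_l g x) ('D_k g x) ('D_k ('D_l g) x).
  move=> b bl bk bkl a al ak akl.
  move: m n mn => [|[|[|m]]] [|[|[|n]]]// _;
  do 8! (move=> /(_ isT) -> || move=> _);
  by rewrite ?(mulr0, mul0r, addr0).
Qed.
End Vanishing.

(** * Polynomials in functions of known order *)

Section Polynomials.
Context (R : realType) (V : normedModType R) (k l : V) (x : V).

Lemma vanishing_sum (I : Type) (r : seq I) (P : pred I) n (F : I -> V -> R) :
  (forall i, P i -> vanishing k l n (F i) x) ->
  vanishing k l n (fun y => \sum_(i <- r | P i) F i y) x.
Proof.
move=> vF; have -> : (fun y => \sum_(i <- r | P i) F i y)
    = \sum_(i <- r | P i) F i by apply/funext => y; rewrite fct_sumE.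
elim/big_rec: _ => [|i f Pi vf]; first exact: vanishing0.
by apply: vanishingD => //; exact: vF.
Qed.

Lemma vanishing_monomial n (t : V -> 'I_n -> R) (b : nat) (m : multinom n) :
  (forall i, vanishing k l b (fun y => t y i) x) ->
  vanishing k l (mdeg m * b) (fun y => \prod_(i < n) t y i ^+ m i) x.
Proof.
move=> vt; rewrite mdegE big_distrl /=.
have -> : (fun y => \prod_(i < n) t y i ^+ m i)
    = \prod_(i < n) (fun y => t y i ^+ m i).
  by apply/funext => y; rewrite fct_prodE.
elim/big_ind2: _ => [|f a g a' vf va|i _]; first exact: vanishing_cst.
  exact: vanishingM.
elim: (m i) => [|e IHe]; first exact: vanishing_cst.
rewrite mulSn; have -> : (fun y => t y i ^+ e.+1)
    = (fun y => t y i) * (fun y => t y i ^+ e).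
  by apply/funext => y; rewrite exprS.
exact: vanishingM.
Qed.

Lemma vanishing_mpeval n (f : mpoly n R) (z : V -> 'rV[R]_n) :
  (forall i, vanishing k l 0 (fun y => z y 0 i) x) ->
  vanishing k l 0 (fun y => mpeval f (z y)) x.
Proof.
move=> vz; have -> : (fun y => mpeval f (z y)) = fun y =>
    \sum_(m <- msupp f)
      (cst (mcoeff m f) * (fun y => \prod_(i < n) z y 0 i ^+ m i)) y.
  by apply/funext => y; rewrite /mpeval mevalE.
apply: vanishing_sum => m _; apply: (@vanishingM _ _ _ _ 0 0).
  exact: vanishing_cst.
by have := @vanishing_monomial _ (fun y i => z y 0 i) 0 m vz; rewrite muln0.
Qed.

(** [eval_in_t] evaluates the coefficients first, which yields a polynomial
    whose support may be smaller than that of h; summing over the support of h keeps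
    the index set independent of the point. *)
Lemma eval_in_tE d p (h : poly_in_t R d p) (X : 'rV[R]_d) (u : 'rV[R]_p)
    (etau t : 'rV[R]_d) :
  eval_in_t h X u etau t =
  \sum_(m <- msupp h) mpeval (mcoeff m h) (row_mx (row_mx X u) etau)
                      * \prod_(i < d) t 0 i ^+ m i.
Proof.
rewrite /eval_in_t /mpeval /map_mpoly /mmap raddf_sum /=.
by apply: eq_bigr => m _; rewrite mevalM mevalC /mmap1 -mpolyXE_id mevalX.
Qed.

(** Each monomial in t is cubic, hence vanishes to order 3 by multiplicativity;
    the coefficients, though depending on X and so on the point, are regular
    and cannot lower this order. *)
Lemma vanishing_eval_in_t d p (h : poly_in_t R d p) (X t : V -> 'rV[R]_d)
    (u : 'rV[R]_p) (etau : 'rV[R]_d) :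
  cubic_in_t h -> (forall i, vanishing k l 0 (fun y => X y 0 i) x) ->
  (forall i, vanishing k l 1 (fun y => t y 0 i) x) ->
  vanishing k l 3 (fun y => eval_in_t h (X y) u etau (t y)) x.
Proof.
move=> /allP h3 vX vt.
have -> : (fun y => eval_in_t h (X y) u etau (t y)) = fun y =>
    \sum_(m <- msupp h)
      ((fun y => mpeval (mcoeff m h) (row_mx (row_mx (X y) u) etau))
       * (fun y => \prod_(i < d) t y 0 i ^+ m i)) y.
  by apply/funext => y; rewrite eval_in_tE.
rewrite (_ : (fun y => _) = fun y =>
    \sum_(m <- msupp h | mdeg m == 3%N)
      ((fun y => mpeval (mcoeff m h) (row_mx (row_mx (X y) u) etau))
       * (fun y => \prod_(i < d) t y 0 i ^+ m i)) y); last first.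
  by apply/funext => y; rewrite big_seq_cond [RHS]big_seq_cond;
    apply: eq_bigl => m; rewrite andbT;
    case: (boolP (m \in _)) => //= /h3 /= ->.
apply: vanishing_sum => m /eqP m3; apply: (@vanishingM _ _ _ _ 0 3).
  apply: vanishing_mpeval => i; case: (split_ordP i) => j ->.
    rewrite (_ : (fun y => _) = fun y => row_mx (X y) u 0 j); last first.
      by apply/funext => y; rewrite row_mxEl.
    case: (split_ordP j) => a ->.
      rewrite (_ : (fun y => _) = fun y => X y 0 a); first exact: vX.
      by apply/funext => y; rewrite row_mxEl.
    rewrite (_ : (fun y => _) = cst (u 0 a)); first exact: vanishing_cst.
    by apply/funext => y; rewrite row_mxEr.
  rewrite (_ : (fun y => _) = cst (etau 0 j)); first exact: vanishing_cst.
  by apply/funext => y; rewrite row_mxEr.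
by have := @vanishing_monomial _ (fun y i => t y 0 i) 1 m vt; rewrite m3.
Qed.
End Polynomials.

(** * Restriction to the slices of constant u *)

Section Slice.
Context (R : realType) (U V W : normedModType R) (f : U * V -> W) (u : U).

Lemma slice_quotient (v h : V) :
  (fun s : R => s^-1 *: ((f \o shift (u, v)) (s *: ((0 : U), h)) - f (u, v)))
  = (fun s : R =>
       s^-1 *: (((fun y => f (u, y)) \o shift v) (s *: h) - f (u, v))).
Proof.
apply/funext => s /=.
suff -> : s *: ((0 : U), h) + (u, v) = (u, s *: h + v) by [].
by congr pair; rewrite /= scaler0 add0r.
Qed.

Lemma derive_slice (v h : V) :
  'D_((0 : U), h) f (u, v) = 'D_h (fun y => f (u, y)) v.
Proof. by rewrite /derive slice_quotient. Qed.

Lemma derivable_slice (v h : V) :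
  derivable f (u, v) ((0 : U), h) -> derivable (fun y => f (u, y)) v h.
Proof. by rewrite /derivable slice_quotient. Qed.
End Slice.

Lemma derive2_slice (R : realType) (U V W : normedModType R) (f : U * V -> W)
    (u : U) (v k l : V) :
  'D_((0 : U), k) ('D_((0 : U), l) f) (u, v)
  = 'D_k ('D_l (fun y => f (u, y))) v.
Proof.
have Dl : (fun y => 'D_((0 : U), l) f (u, y)) = 'D_l (fun y => f (u, y)).
  by apply/funext => y; exact: derive_slice.
by rewrite -Dl -(derive_slice ('D_((0 : U), l) f)).
Qed.

Lemma near_slice (R : realType) (U V : normedModType R) (u : U) (v : V)
    (P : set (U * V)) :
  nbhs (u, v) P -> \forall y \near v, P (u, y).
Proof.
move=> /= [[A B] [/= nA nB] AB]; apply: filterS nB => y By.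
by apply: AB; split => //=; exact: nbhs_singleton nA.
Qed.

Lemma derivable_entry (R : realType) (V : normedModType R) (d : nat)
    (f : V -> 'rV[R]_d) (x h : V) (i : 'I_d) :
  derivable f x h -> derivable (fun y => f y 0 i) x h.
Proof. by move=> /derivable_mxP; exact. Qed.

Lemma derive_entry (R : realType) (V : normedModType R) (d : nat)
    (f : V -> 'rV[R]_d) (x h : V) (i : 'I_d) :
  derivable f x h -> 'D_h (fun y => f y 0 i) x = ('D_h f x) 0 i.
Proof. by move=> fx; rewrite (derive_mx fx) mxE. Qed.

(** W is open, so a whole neighbourhood of v in the slice lies in W; there the
    derivative of the slice is the restriction of a directional derivative of f,
    which is differentiable at (u, v). *)
Lemma twice_differentiable_slice (R : realType) (U V : normedModType R)
    (d : nat) (W : set (U * V)) (f : U * V -> 'rV[R]_d) (u : U) (v k l : V)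
    (i : 'I_d) :
  open W -> twice_differentiable_on W f -> W (u, v) ->
  vanishing k l 0 (fun y => f (u, y) 0 i) v.
Proof.
move=> oW fW Wuv.
have nW : \forall y \near v, W (u, y).
  by apply: near_slice; exact: open_nbhs_nbhs.
have df h w : W w -> derivable f w h.
  by move=> /fW[dfw _]; exact: diff_derivable.
have ds h y : W (u, y) -> derivable (fun y => f (u, y)) y h.
  by move=> Wy; apply: derivable_slice; exact: df.
split=> [| | |//|//|//|//].
- by apply: filterS nW => y Wy; apply: derivable_entry; exact: ds.
- by apply: derivable_entry; exact: ds.
- have Dl : \forall y \near v, ('D_((0 : U), l) f (u, y)) 0 i
      = 'D_l (fun y => f (u, y) 0 i) y.
    apply: filterS nW => y Wy.
    by rewrite (derive_entry i (ds l y Wy)) derive_slice.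
  apply: near_eq_derivable Dl _.
  apply: (@derivable_entry _ _ _ (fun y => 'D_((0 : U), l) f (u, y))).
  apply: (@derivable_slice _ _ _ _ ('D_((0 : U), l) f)).
  by apply: diff_derivable; exact: (fW _ Wuv).2.
Qed.

Lemma derive2_lincomb (R : realType) (V : normedModType R) (k l x : V) (d : nat)
    (f : 'I_d -> V -> R) (b : 'I_d -> R) :
  (forall i, vanishing k l 0 (f i) x) ->
  'D_k ('D_l (fun y => \sum_(i < d) f i y * b i)) x
  = \sum_(i < d) 'D_k ('D_l (f i)) x * b i.
Proof.
move=> vf.
have D_lc (h y : V) (g : 'I_d -> V -> R) : (forall i, derivable (g i) y h) ->
    'D_h (fun y => \sum_(i < d) g i y * b i) y
    = \sum_(i < d) 'D_h (g i) y * b i.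
  move=> dg; have -> : (fun y => \sum_(i < d) g i y * b i)
      = \sum_(i < d) (b i \*: g i).
    apply/funext => z; rewrite fct_sumE; apply: eq_bigr => i _.
    by rewrite mulrC.
  rewrite derive_sum; last by move=> i; exact: derivableZ.
  by apply: eq_bigr => i _; rewrite (deriveZ _ (dg i)) mulrC.
have Dl : \forall y \near x, 'D_l (fun y => \sum_(i < d) f i y * b i) y
    = \sum_(i < d) 'D_l (f i) y * b i.
  have nf : \forall y \near x, forall i, derivable (f i) y l.
    by apply: filter_forall => i; exact: (van_derl (vf i)).
  by apply: filterS nf => y; exact: D_lc.
by rewrite (near_eq_derive k Dl); apply: D_lc => i; exact: (van_derkl (vf i)).
Qed.

(** * The derivatives of the natural parameter and the span of the e_j *)

(** A vector w with A G w^T = 0 is, by that same equation, Euclidean-orthogonal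
    to the rows of A G; hence those rows are orthogonal to all such w. *)
Lemma sub_orth_orth (R : realType) (d m : nat) (G : 'M[R]_d)
    (A : 'M[R]_(m, d)) :
  (A *m G <= orth 1%:M (orth G A))%MS.
Proof.
rewrite /orth mulmx1; apply/sub_kermxP; rewrite -[LHS]trmxK trmx_mul !trmxK.
by rewrite mulmx_ker trmx0.
Qed.

Lemma derive_gradient_comp (R : realType) (V : normedModType R) (d : nat)
    (psi : 'rV[R]_d -> R) (theta : V -> 'rV[R]_d) (x h : V) :
  (forall z, differentiable ('D_z psi) (theta x)) -> differentiable theta x ->
  \row_j 'D_h (fun y => gradient psi (theta y) 0 j) x
  = (\row_i 'D_h (fun y => theta y 0 i) x) *m hessian psi (theta x).
Proof.
move=> dpsi dtheta; have dth := @diff_derivable _ _ _ theta x h dtheta.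
apply/rowP => j; rewrite !mxE.
have -> : (fun y => gradient psi (theta y) 0 j)
    = 'D_(delta_mx 0 j) psi \o theta by apply/funext => y; rewrite mxE.
rewrite deriveE; last exact: differentiable_comp.
rewrite diff_comp //= -(deriveE _ dtheta) (derive_mx dth).
rewrite [X in 'd _ _ X]row_sum_delta linear_sum /=; apply: eq_bigr => i _.
by rewrite linearZ /= !mxE -deriveE.
Qed.

(** On the open set W one has eta = grad psi o theta, so this is the chain rule;
    it identifies the Hessian of psi, i.e. the Fisher metric, as the map sending
    d theta / d u to d eta / d u. *)
Lemma tangent_mx_natural (R : realType) (d p : nat)
    (nu : {measure set (d.-tuple (measurableTypeR R)) -> \bar R})
    (psi : 'rV[R]_d -> R) (Theta VTheta : set 'rV[R]_d)
    (W : set ('rV[R]_p * 'rV[R]_(d - p)))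
    (thetauv etauv : 'rV[R]_p * 'rV[R]_(d - p) -> 'rV[R]_d)
    (u0 u : 'rV[R]_p) :
  exponential_family nu psi Theta ->
  estimator (expectation_param nu psi) Theta VTheta W thetauv etauv u0 ->
  W (u, 0) ->
  tangent_mx etauv u
  = (\matrix_(a, i) 'D_(dir_u R (d - p) a) (fun w => thetauv w 0 i) (u, 0))
    *m hessian psi (thetauv (u, 0)).
Proof.
move=> family coords Wu.
have [Th _ dtheta] := est_natural coords Wu.
have eta_grad : \forall w \near (u, 0 : 'rV[R]_(d - p)),
    etauv w = gradient psi (thetauv w).
  have := open_nbhs_nbhs (conj (est_open coords) Wu).
  apply: filterS => w Ww.
  have [Tw <- _] := est_natural coords Ww.
  by rewrite (ef_expectation family Tw).
apply/row_matrixP => a; rewrite row_mul.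
transitivity (\row_j 'D_(dir_u R (d - p) a)
                (fun w => gradient psi (thetauv w) 0 j) (u, 0)).
  apply/rowP => j; rewrite !mxE; apply: near_eq_derive.
  by apply: filterS eta_grad => w ->.
rewrite (derive_gradient_comp _ (ef_smooth family Th).2 dtheta).
by congr (_ *m _); apply/rowP => i; rewrite !mxE.
Qed.

(** * Second derivatives of an estimator with cubic perturbation *)

Lemma derive_subcst (R : realType) (V : normedModType R) (f : V -> R) (a : R)
    (h : V) :
  'D_h (fun y => f y - a) = 'D_h f.
Proof.
apply/funext => x; rewrite /derive.
have -> : (fun s : R => s^-1 *: (((fun y => f y - a) \o shift x) (s *: h)
      - (f x - a)))
    = (fun s : R => s^-1 *: ((f \o shift x) (s *: h) - f x)).
  by apply/funext => s /=; rewrite opprB addrA subrK.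
by [].
Qed.

(** The equation makes the component of X - X(x) along b equal to a function
    vanishing to order 3 at x, whose second derivatives are therefore zero. *)
Lemma cubic_equation_derive2 (R : realType) (V : normedModType R) (d p : nat)
    (k l x : V) (X : V -> 'rV[R]_d) (u : 'rV[R]_p) (b : 'rV[R]_d) (c : R)
    (h : poly_in_t R d p) :
  cubic_in_t h -> (forall i, vanishing k l 0 (fun y => X y 0 i) x) ->
  (\forall y \near x, \sum_(i < d) (X y - X x) 0 i * b 0 i
     + c * eval_in_t h (X y) u (X x) (X y - X x) = 0) ->
  \sum_(i < d) 'D_k ('D_l (fun y => X y 0 i)) x * b 0 i = 0.
Proof.
move=> h3 vX eqX.
have tE i : (fun y => (X y - X x) 0 i) = (fun y => X y 0 i - X x 0 i).
  by apply/funext => y; rewrite !mxE.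
have vt0 i : vanishing k l 0 (fun y => (X y - X x) 0 i) x.
  by rewrite tE; exact: vanishingD (vX i) (vanishing_cst k l (- X x 0 i) x).
have vt i : vanishing k l 1 (fun y => (X y - X x) 0 i) x.
  case: (vt0 i) => dl dk dkl _ _ _ _.
  by split=> [| | | |//|//|//];
    [exact: dl|exact: dk|exact: dkl|rewrite subrr mxE].
rewrite (eq_bigr (fun i => 'D_k ('D_l (fun y => (X y - X x) 0 i)) x * b 0 i));
  last by move=> i _; rewrite tE derive_subcst.
rewrite -(derive2_lincomb (fun i => b 0 i) vt0).
pose Q y := eval_in_t h (X y) u (X x) (X y - X x).
have vcQ : vanishing k l 3 (cst (- c) * Q) x.
  apply: (@vanishingM _ _ _ _ 0 3); first exact: vanishing_cst.
  exact: vanishing_eval_in_t.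
rewrite (_ : 'D_k _ x = 'D_k ('D_l (cst (- c) * Q)) x);
  first exact: van_dkl vcQ _.
apply: near_eq_derive2; apply: filterS eqX => y /eqP.
by rewrite addr_eq0 => /eqP ->; rewrite -mulNr.
Qed.

(** * Second-order efficiency *)

Theorem theorem3 (R : realType) (d p : nat) (le_pd : (p <= d)%N)
  (nu : {measure set (d.-tuple (measurableTypeR R)) -> \bar R})
  (psi : 'rV[R]_d -> R) (Theta : set 'rV[R]_d)
  (family : exponential_family nu psi Theta)
  (VTheta : set 'rV[R]_d)
  (W : set ('rV[R]_p * 'rV[R]_(d - p)))
  (thetauv etauv : 'rV[R]_p * 'rV[R]_(d - p) -> 'rV[R]_d)
  (u0 : 'rV[R]_p)
  (model : algebraic_model p (expectation_param nu psi) Theta VTheta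
             (thetauv (u0, 0)))
  (coords : estimator (expectation_param nu psi) Theta VTheta
              W thetauv etauv u0)
  (c : R)
  (e : 'I_p -> poly_vector R d p)
  (e_span : forall u : 'rV[R]_p, W (u, 0) ->
     let Gbar := invmx (hessian psi (thetauv (u, 0))) in
     (\matrix_(j < p) eval_vector (e j) u (etauv (u, 0))
        == orth 1%:M (orth Gbar (tangent_mx etauv u)))%MS)
  (h : 'I_p -> poly_in_t R d p)
  (h_cubic : forall j : 'I_p, cubic_in_t (h j))
  (equations : forall (u : 'rV[R]_p) (v : 'rV[R]_(d - p)),
     W (u, v) -> W (u, 0) ->
     let X := etauv (u, v) in
     let etau := etauv (u, 0) in
     forall j : 'I_p,
       \sum_(i < d) (X - etau) 0 i * eval_vector (e j) u etau 0 i
         + c * eval_in_t (h j) X u etau (X - etau) = 0) :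
  forall (u : 'rV[R]_p), W (u, 0) ->
  forall (kappa lambda : 'I_(d - p)) (a : 'I_p),
    \sum_(i < d)
      'D_(dir_v R p kappa) ('D_(dir_v R p lambda) (fun w => etauv w 0 i)) (u, 0)
      * 'D_(dir_u R (d - p) a) (fun w => thetauv w 0 i) (u, 0) = 0.
Proof.
move=> u Wu kappa lambda a.
pose theta := thetauv (u, 0).
have [Th _ _] := est_natural coords Wu.
pose T : 'M[R]_(p, d) :=
  \matrix_(a, i) 'D_(dir_u R (d - p) a) (fun w => thetauv w 0 i) (u, 0).
pose E := \matrix_(j < p) eval_vector (e j) u (etauv (u, 0)).
(* The tangent matrix is T H, so multiplying it by Gbar = H^-1 recovers T. *)
have TE : (T <= E)%MS.
  have -> : T = tangent_mx etauv u *m invmx (hessian psi theta).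
    rewrite (tangent_mx_natural family coords Wu) mulmxK//.
    exact: ef_nondegenerate family _ Th.
  by rewrite (eqmxP (e_span u Wu)); exact: sub_orth_orth.
have [M TM] := submxP TE.
(* As T = M E, only the orthogonality of D2 to every row of E is left. *)
pose D2 i := 'D_(dir_v R p kappa) ('D_(dir_v R p lambda)
  (fun w => etauv w 0 i)) (u, 0).
have D2E (i : 'I_d) : D2 i = 'D_(delta_mx 0 kappa)
    ('D_(delta_mx 0 lambda) (fun v => etauv (u, v) 0 i)) 0.
  exact: (derive2_slice (fun w => etauv w 0 i) u 0 (delta_mx 0 kappa)).
have orthE (j : 'I_p) : \sum_(i < d) D2 i * E j i = 0.
  rewrite (eq_bigr (fun i => 'D_(delta_mx 0 kappa) ('D_(delta_mx 0 lambda)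
    (fun v => etauv (u, v) 0 i)) 0 * eval_vector (e j) u (etauv (u, 0)) 0 i));
    last by move=> i _; rewrite D2E [E j i]mxE.
  apply: (@cubic_equation_derive2 _ _ _ _ _ _ _ (fun v => etauv (u, v)) u _ c
    (h j)) => //.
    move=> i; apply: twice_differentiable_slice (est_open coords)
      (est_smooth coords) Wu.
  have : \forall v \near (0 : 'rV[R]_(d - p)), W (u, v).
    by apply: near_slice; apply: open_nbhs_nbhs; split=> //;
      exact: est_open coords.
  by apply: filterS => v Wv; exact: (equations u v Wv Wu j).
transitivity (\sum_(i < d) D2 i * T a i).
  by apply: eq_bigr => i _; rewrite [T a i]mxE.
transitivity (\sum_(j < p) M a j * \sum_(i < d) D2 i * E j i).
  under [RHS]eq_bigr do rewrite big_distrr.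
  rewrite exchange_big; apply: eq_bigr => i _.
  rewrite TM mxE big_distrr; apply: eq_bigr => j _ /=.
  by rewrite mulrCA.
by apply: big1 => j _; rewrite orthE mulr0.
Qed.
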